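(* Suppose problem $\mathcal{PE}$ has a non-empty feasible set, and in problem $\mathcal{MPC}$ let $W=W^\ast$ and $P=P^\ast$, where $W^\ast,P^\ast$ are maximizers of problem $\mathcal{PE}$. Let $N\ge1$, let $\mathcal{X}_N$ be the set of initial states for which problem $\mathcal{MPC}$ is feasible, and suppose the initial state $x_0$ lies within $\mathcal X_N$. Then, under the model predictive control law $\pi^{MPC}(x_k)=\pi^\ast_{k|k}(x_{k|k})$, the closed-loop system $x_{k+1}=A(w_k)x_k+B(w_k)\pi^{MPC}(x_k)$ is Uniformly Locally Risk-Sensitive Exponentially Stable (ULRSES) with domain $\mathcal X_N$.
   Context: System: $x_{k+1}=A(w_k)x_k+B(w_k)u_k$, $k\in\{0,1,2,\dots\}$, with $x_k\in\mathbb{R}^{N_x}$, $u_k\in\mathbb{R}^{N_u}$, $x_0$ deterministic. The disturbances $w_k$ are independent of each other and of the past, taking values in a finite set $\mathcal W=\{w^{[1]},\dots,w^{[L]}\}$ with time-invariant pmf $p$, $p(j)=\mathbb{P}(w_k=w^{[j]})>0$. Write $A_j=A(w^{[j]})$, $B_j=B(w^{[j]})$. Risk measure: $\mathcal U^{\mathrm{poly}}$ is a fixed (independent of time and state) non-empty polytope of pmfs, $\mathcal U^{\mathrm{poly}}=\{q\in\Delta^L : S^I q\le T^I,\ S^E q=T^E\}$, $\Delta^L=\{q\in\mathbb{R}^L: q\ge 0,\ \sum_j q(j)=1\}$; its finite set of vertices is $\mathcal U^{\mathrm{poly},V}$. For a real random variable $Z$ depending on $w_0,\dots,w_k$, $\rho_k(Z)$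 is the function of $w_0,\dots,w_{k-1}$ given by $\rho_k(Z)=\max_{q\in\mathcal U^{\mathrm{poly}}}\sum_{j=1}^L q(j)\,Z(w_0,\dots,w_{k-1},w^{[j]})$. The Markov dynamic polytopic risk measure is $\rho_{k,M}(Z_k,\dots,Z_M)=Z_k+\rho_k(Z_{k+1}+\rho_{k+1}(Z_{k+2}+\dots+\rho_{M-1}(Z_M)\dots))$. ULRSES: a closed-loop system is ULRSES with domain $\Omega$, a bounded neighborhood of the origin, if there exist constants $c\ge0$ and $\lambda\in[0,1)$ such that for all initial conditions $x_0\in\Omega$, $\rho_{0,k}(0,\dots,0,x_k^\top x_k)\le c\,\lambda^k\,x_0^\top x_0$ for all $k\in\mathbb N$. The risk measure here is the same one used in the MPC cost. Costs and constraints: $C(x,u)=x^\top Qx+u^\top Ru$ with $Q=Q^\top\succ0$, $R=R^\top\succ0$. $\mathbb X=\{x\in\mathbb{R}^{N_x}:\|T_xx\|_2\le x_{\max}\}$ and $\mathbb U=\{u\in\mathbb{R}^{N_u}:\|T_uu\|_2\le u_{\max}\}$ are compact convex sets, with $x_{\max},u_{\max}>0$. For $W=W^\top\succ0$, $\mathcal E_{\max}(W)=\{x\in\mathbb{R}^{N_x}: x^\top W^{-1}x\le 1\}$. Problem $\mathcal{PE}$: maximize $\log\det(W)$ over $W=W^\top\succ0$, $P=P^\top\succ0$, $F\in\mathbb{R}^{N_u\times N_x}$ subject to (a) $F^\top \frac{T_u^\top T_u}{u_{\max}^2}F-W^{-1}\preceq0$; (b) $\sum_{j=1}^L q_l(j)(A_j+B_jF)^\top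 P(A_j+B_jF)-P+(F^\top RF+Q)\prec0$ for all $q_l\in\mathcal U^{\mathrm{poly},V}$; and for all $j\in\{1,\dots,L\}$: (c) $(A_j+B_jF)^\top\frac{T_x^\top T_x}{x_{\max}^2}(A_j+B_jF)-W^{-1}\preceq0$; (d) $(A_j+B_jF)^\top W^{-1}(A_j+B_jF)-W^{-1}\preceq0$. Problem $\mathcal{MPC}$: given the current state $x_{k|k}\in\mathbb X$ and horizon $N\ge1$, minimize, over policies $\pi_{k+h|k}:\mathbb X\to\mathbb U$, $h=0,\dots,N-1$, the cost $\rho_{k,k+N}\big(C(x_{k|k},\pi_{k|k}(x_{k|k})),\dots,C(x_{k+N-1|k},\pi_{k+N-1|k}(x_{k+N-1|k})),\,x_{k+N|k}^\top P x_{k+N|k}\big)$ subject to $x_{k+h+1|k}=A(w_{k+h})x_{k+h|k}+B(w_{k+h})\pi_{k+h|k}(x_{k+h|k})$, $\pi_{k+h|k}(x_{k+h|k})\in\mathbb U$, $x_{k+h+1|k}\in\mathbb X$ for $h\in\{0,\dots,N-1\}$, and $x_{k+N|k}\in\mathcal E_{\max}(W)$, all holding surely (for every disturbance realization). A minimizing policy is denoted $\{\pi^\ast_{k|k},\dots,\pi^\ast_{k+N-1|k}\}$, and the (time-invariant) model predictive control law is $\pi^{MPC}(x_k)=\pi^\ast_{k|k}(x_{k|k})$ with $x_{k|k}=x_k$. *)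

(* Defs.v *)
From HB Require Import structures.
From mathcomp Require Import all_boot all_order all_algebra.
From mathcomp Require Import all_classical all_reals all_analysis.

Set Implicit Arguments.
Unset Strict Implicit.
Unset Printing Implicit Defensive.

Import Order.TTheory GRing.Theory Num.Theory.
Import numFieldNormedType.Exports.

Local Open Scope classical_set_scope.
Local Open Scope ring_scope.

Section Matrices.
Variable R : realType.

Definition qform n (M : 'M[R]_n) (x : 'cV[R]_n) : R := (x^T *m M *m x) 0 0.

Definition sqnorm n (x : 'cV[R]_n) : R := (x^T *m x) 0 0.

(* The norm `|x| that the library puts on 'cV[R]_n is the sup norm. *)
Definition norm2 n (x : 'cV[R]_n) : R := Num.sqrt (sqnorm x).

Definition posdef n (M : 'M[R]_n) : Prop :=
  M^T = M /\ forall x, x != 0 -> 0 < qform M x.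

Definition negdef n (M : 'M[R]_n) : Prop :=
  M^T = M /\ forall x, x != 0 -> qform M x < 0.

Definition negsemidef n (M : 'M[R]_n) : Prop :=
  M^T = M /\ forall x, qform M x <= 0.

Definition ball_constraint m n (T : 'M[R]_(m, n)) (r : R) : set 'cV[R]_n :=
  [set x | norm2 (T *m x) <= r].

Definition ellipsoid n (W : 'M[R]_n) : set 'cV[R]_n :=
  [set x | qform (invmx W) x <= 1].

End Matrices.

Section Risk.
Variables (R : realType) (L : nat).

Definition simplex : set 'cV[R]_L :=
  [set q | (forall j, 0 <= q j 0) /\ \sum_j q j 0 = 1].

Definition polytope mI mE (SI : 'M[R]_(mI, L)) (TI : 'cV[R]_mI)
    (SE : 'M[R]_(mE, L)) (TE : 'cV[R]_mE) : set 'cV[R]_L :=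
  [set q | [/\ simplex q, forall i, (SI *m q) i 0 <= TI i 0 & SE *m q = TE]].

Definition vertices (U : set 'cV[R]_L) : set 'cV[R]_L :=
  [set q | U q /\ forall a b (t : R), U a -> U b -> 0 < t < 1 ->
     q = t *: a + (1 - t) *: b -> a = q /\ b = q].

(* The value w^[j] of a disturbance is represented by its index j : 'I_L, and
   a random variable is a function of the whole disturbance path. *)
Definition dpath := nat -> 'I_L.
Definition rvar := dpath -> R.

(* For Z depending on w_0, ..., w_k only, risk U k Z depends on
   w_0, ..., w_{k-1} only. The supremum is a maximum when U is a non-empty
   polytope of probability mass functions. *)
Definition risk (U : set 'cV[R]_L) (k : nat) (Z : rvar) : rvar := fun w =>
  sup [set \sum_j q j 0 * Z [eta w with k |-> j] | q in U].

Fixpoint nested_risk (U : set 'cV[R]_L) (n k : nat) (Z : nat -> rvar) : rvar :=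
  if n is n'.+1 then
    fun w => Z k w + risk U k (nested_risk U n' k.+1 Z) w
  else Z k.

(* rho_{k,M}(Z_k, ..., Z_M), for k <= M *)
Definition markov_risk (U : set 'cV[R]_L) (k M : nat) (Z : nat -> rvar) : rvar :=
  nested_risk U (M - k) k Z.

End Risk.

Section Stability.
Variables (R : realType) (L nx : nat).

Fixpoint state (f : 'I_L -> 'cV[R]_nx -> 'cV[R]_nx) (x0 : 'cV[R]_nx)
    (w : dpath L) (k : nat) : 'cV[R]_nx :=
  if k is k'.+1 then f (w k') (state f x0 w k') else x0.

Definition ulrses (U : set 'cV[R]_L) (f : 'I_L -> 'cV[R]_nx -> 'cV[R]_nx)
    (Omega : set 'cV[R]_nx) : Prop :=
  [/\ nbhs (0 : 'cV[R]_nx) Omega,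
      bounded_set Omega
    & exists c lambda : R, [/\ 0 <= c, 0 <= lambda < 1
    & forall x0, Omega x0 -> forall (k : nat) (w : dpath L),
        markov_risk U 0 k
          (fun i w' => if i == k then sqnorm (state f x0 w' k) else 0) w
        <= c * lambda ^+ k * sqnorm x0]].

End Stability.

Section Control.
Variables (R : realType) (L nx nu : nat).
Variables (A : 'I_L -> 'M[R]_nx) (B : 'I_L -> 'M[R]_(nx, nu)).
Variables (U : set 'cV[R]_L).
Variables (Q : 'M[R]_nx) (Ru : 'M[R]_nu).

Definition closed_loop (pi : 'cV[R]_nx -> 'cV[R]_nu)
    (j : 'I_L) (x : 'cV[R]_nx) : 'cV[R]_nx :=
  A j *m x + B j *m pi x.

Definition stage_cost (x : 'cV[R]_nx) (u : 'cV[R]_nu) : R :=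
  qform Q x + qform Ru u.

Section PE.
Variables (mx mu : nat) (Tx : 'M[R]_(mx, nx)) (xmax : R).
Variables (Tu : 'M[R]_(mu, nu)) (umax : R).

Definition pe_feasible (W P : 'M[R]_nx) (F : 'M[R]_(nu, nx)) : Prop :=
  [/\ posdef W,
      posdef P,
      negsemidef (F^T *m ((umax ^+ 2)^-1 *: (Tu^T *m Tu)) *m F - invmx W),
      forall q, vertices U q ->
        negdef (\sum_j q j 0 *: ((A j + B j *m F)^T *m P *m (A j + B j *m F))
                - P + (F^T *m Ru *m F + Q))
    & forall j,
        negsemidef ((A j + B j *m F)^T *m ((xmax ^+ 2)^-1 *: (Tx^T *m Tx))
                    *m (A j + B j *m F) - invmx W)
        /\ negsemidef ((A j + B j *m F)^T *m invmx W *m (A j + B j *m F)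
                       - invmx W)].

Definition pe_maximizer (W P : 'M[R]_nx) (F : 'M[R]_(nu, nx)) : Prop :=
  pe_feasible W P F /\
  forall W' P' F', pe_feasible W' P' F' -> ln (\det W') <= ln (\det W).

End PE.

Section MPC.
Variables (XX : set 'cV[R]_nx) (UU : set 'cV[R]_nu).
Variables (W P : 'M[R]_nx) (N : nat).

(* pi h is the feedback applied at prediction step h. *)
Definition policy := nat -> 'cV[R]_nx -> 'cV[R]_nu.

(* pred_state k x pi w h is x_{k+h|k}, with x_{k|k} = x. *)
Fixpoint pred_state (k : nat) (x : 'cV[R]_nx) (pi : policy) (w : dpath L)
    (h : nat) : 'cV[R]_nx :=
  if h is h'.+1 then
    closed_loop (pi h') (w (k + h')%N) (pred_state k x pi w h')
  else x.

(* A policy step is a map XX -> UU; its values outside XX are irrelevant. *)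
Definition mpc_feasible (k : nat) (x : 'cV[R]_nx) (pi : policy) : Prop :=
  [/\ XX x,
      forall h, (h < N)%N -> forall y, XX y -> UU (pi h y)
    & forall w : dpath L,
        (forall h, (h < N)%N ->
           UU (pi h (pred_state k x pi w h)) /\ XX (pred_state k x pi w h.+1))
        /\ ellipsoid W (pred_state k x pi w N)].

Definition mpc_cost (k : nat) (x : 'cV[R]_nx) (pi : policy) : rvar R L :=
  markov_risk U k (k + N) (fun i w =>
    let y := pred_state k x pi w (i - k) in
    if (i < k + N)%N then stage_cost y (pi (i - k)%N y) else qform P y).

(* mpc_cost is constant in w: predictions made at time k from a given state
   do not involve w_0, ..., w_{k-1}. *)
Definition mpc_minimizer (k : nat) (x : 'cV[R]_nx) (pi : policy) : Prop :=
  mpc_feasible k x pi /\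
  forall pi', mpc_feasible k x pi' ->
  forall w, mpc_cost k x pi w <= mpc_cost k x pi' w.

Definition mpc_domain : set 'cV[R]_nx :=
  [set x | exists pi, mpc_feasible 0 x pi].

(* Minimizers need not be unique: pi is any law obtained by choosing one at
   each feasible state. *)
Definition mpc_law (pi : 'cV[R]_nx -> 'cV[R]_nu) : Prop :=
  forall (k : nat) x, mpc_domain x ->
  exists2 pistar, mpc_minimizer k x pistar & pi x = pistar 0%N x.

End MPC.
End Control.

(* Main.v *)
Require Import Defs.
From HB Require Import structures.
From mathcomp Require Import all_boot all_order all_algebra.
From mathcomp Require Import all_classical all_reals all_analysis.
From mathcomp Require Import ring lra.

Set Implicit Arguments.
Unset Strict Implicit.
Unset Printing Implicit Defensive.

Import Order.TTheory GRing.Theory Num.Theory.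
Import numFieldNormedType.Exports.

Local Open Scope classical_set_scope.
Local Open Scope ring_scope.

(** Under the constraints of the offline problem the linear feedback F keeps
    the ellipsoid invariant, respects the input and state constraints there,
    and makes the terminal cost x^T P x decrease, in worst-case expectation, by
    at least the stage cost (terminal_invariant, terminal_decrease). The
    matrix inequality behind the last point is only imposed at the vertices of
    the polytope, which suffices because a linear functional on a compact set
    attains its maximum at an extreme point (vertex_max_mean).

    The optimal cost V of the predictive controller is then a Lyapunov
    function. Dropping the first stage of an optimal policy and appending F at
    the end gives an admissible policy for every successor state, of cost at
    most that of the remaining stages; hence the domain is invariant and the
    one-step risk of V at the successor is at most V x - x^T Q x
    (mpc_value_decrease). Moreover V dominates x^T Q x, because all
    other terms are nonnegative, and it is dominated by a multiple of |x|^2: on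
    the ellipsoid V x <= x^T P x, and off the ellipsoid V is bounded, because
    states and inputs range over compact sets, while x^T W^-1 x > 1.
    Since quadratic forms are comparable with positive definite ones
    (qform_le_posdef), the risk of V contracts by a factor lambda < 1 at each
    step, and monotonicity and positive homogeneity of the one-step risk turn
    this into geometric decay of the nested risk (lyapunov_ulrses).

    Everything is carried out on a backward recursion over states
    (nested_risk_bellman), in which disturbance paths no longer occur. *)

(** * Quadratic forms *)

Section QuadraticForms.
Variable R : realType.

Lemma qformE n (M : 'M[R]_n) (x : 'cV[R]_n) :
  qform M x = \sum_j \sum_i x i 0 * M i j * x j 0.
Proof.
rewrite /qform mxE; apply: eq_bigr => j _; rewrite mxE mulr_suml.
by apply: eq_bigr => i _; rewrite mxE.
Qed.

Lemma sqnormE n (x : 'cV[R]_n) : sqnorm x = \sum_i x i 0 ^+ 2.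
Proof. by rewrite /sqnorm mxE; apply: eq_bigr => i _; rewrite mxE expr2. Qed.

Lemma sqnorm_gt0 n (x : 'cV[R]_n) : x != 0 -> 0 < sqnorm x.
Proof.
apply: contra_neqT; rewrite -leNgt sqnormE => x0.
have sum0 : \sum_i x i 0 ^+ 2 == 0.
  by rewrite eq_le x0 sumr_ge0// => i _; exact: sqr_ge0.
rewrite psumr_eq0 in sum0; last by move=> i _; exact: sqr_ge0.
apply/colP => i; rewrite mxE; apply/eqP; rewrite -sqrf_eq0.
by move/allP : sum0 => /(_ i); rewrite mem_index_enum => /(_ isT).
Qed.

Lemma norm2_le n (x : 'cV[R]_n) (r : R) : 0 < r ->
  (norm2 x <= r) = (sqnorm x <= r ^+ 2).
Proof.
move=> r0; rewrite /norm2 -[in LHS](ger0_norm (ltW r0)) -sqrtr_sqr ler_sqrt//.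
exact: sqr_ge0.
Qed.

Lemma qform_congr m n (M : 'M[R]_m) (G : 'M[R]_(m, n)) x :
  qform (G^T *m M *m G) x = qform M (G *m x).
Proof. by rewrite /qform trmx_mul !mulmxA. Qed.

Lemma qform_gram m n (T : 'M[R]_(m, n)) x : qform (T^T *m T) x = sqnorm (T *m x).
Proof. by rewrite /qform /sqnorm trmx_mul !mulmxA. Qed.

Lemma qformD n (M M' : 'M[R]_n) x : qform (M + M') x = qform M x + qform M' x.
Proof. by rewrite /qform mulmxDr mulmxDl mxE. Qed.

Lemma qformN n (M : 'M[R]_n) x : qform (- M) x = - qform M x.
Proof. by rewrite /qform mulmxN mulNmx mxE. Qed.

Lemma qformZ n (a : R) (M : 'M[R]_n) x : qform (a *: M) x = a * qform M x.
Proof. by rewrite /qform -scalemxAr -scalemxAl mxE. Qed.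

Lemma qform_sum n (I : finType) (M : I -> 'M[R]_n) x :
  qform (\sum_i M i) x = \sum_i qform (M i) x.
Proof. by rewrite /qform mulmx_sumr mulmx_suml summxE. Qed.

Lemma qformZv n (a : R) (M : 'M[R]_n) x : qform M (a *: x) = a ^+ 2 * qform M x.
Proof.
by rewrite /qform !linearZ/= -!scalemxAl !mxE mulrA expr2.
Qed.

Lemma qform0 n (M : 'M[R]_n) : qform M 0 = 0.
Proof. by rewrite /qform mulmx0 mxE. Qed.

Lemma sqnorm_qform n (x : 'cV[R]_n) : sqnorm x = qform 1%:M x.
Proof. by rewrite /qform mulmx1. Qed.

Lemma posdef_ge0 n (M : 'M[R]_n) x : posdef M -> 0 <= qform M x.
Proof.
move=> [_ M0]; have [->|/M0/ltW//] := eqVneq x 0.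
by rewrite qform0.
Qed.

Lemma qform_continuous n (M : 'M[R]_n) : continuous (qform M).
Proof.
have -> : qform M = fun y => \sum_j \sum_i y i 0 * M i j * y j 0.
  by apply/funext => y; exact: qformE.
apply: continuous_big => [|j _].
  exact: add_continuous.
apply: continuous_big => [|i _ x].
  exact: add_continuous.
apply: (@cvgM _ _ (nbhs x)) (@coord_continuous _ _ _ j 0 x).
exact: (@cvgM _ _ (nbhs x)) (@coord_continuous _ _ _ i 0 x) (cvg_cst _).
Qed.

Lemma sqnorm_continuous n : continuous (@sqnorm R n).
Proof.
have -> : @sqnorm R n = qform 1%:M by apply/funext => x; exact: sqnorm_qform.
exact: qform_continuous.
Qed.

Lemma trmx_continuous m n : continuous (@trmx R m n).
Proof.
move=> M S /= /nbhs_ballP[e e0 eS]; apply/nbhs_ballP; exists e => // N [_ MN].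
by apply: eS; split=> // i j; rewrite !mxE; exact: MN.
Qed.

Lemma compact_colbox n (r : R) :
  compact [set x : 'cV[R]_n | forall i, x i 0 \in `[- r, r]].
Proof.
have -> : [set x : 'cV[R]_n | forall i, x i 0 \in `[- r, r]] =
    trmx @` [set v : 'rV[R]_n | forall i, `[- r, r]%classic (v ord0 i)].
  apply/seteqP; split => [x xr|_ [v vr <-]] /=; last first.
    by move=> i; rewrite mxE; have := vr i; rewrite /= inE.
  exists x^T; last exact: trmxK.
  by move=> i /=; rewrite mxE; exact: xr.
apply: continuous_compact; first exact/continuous_subspaceT/trmx_continuous.
by apply: (@rV_compact R n (fun=> `[- r, r]%classic)) => i; exact: segment_compact.
Qed.

Lemma compact_sphere n : compact [set x : 'cV[R]_n | sqnorm x = 1].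
Proof.
apply: (subclosed_compact _ (@compact_colbox n 1)).
  have -> : [set x : 'cV[R]_n | sqnorm x = 1] = @sqnorm R n @^-1` [set 1] by [].
  by move/continuous_closedP : (@sqnorm_continuous n); apply; exact: closed_eq.
move=> x /= x1 i; rewrite in_itv/= -ler_norml.
rewrite -(@ler_pXn2r _ 2)// ?nnegrE// expr1n real_normK ?num_real//.
by rewrite -x1 sqnormE (bigD1 i)//= lerDl sumr_ge0// => j _; exact: sqr_ge0.
Qed.

(** By homogeneity it is enough to bound the quotient of the two forms on the
    unit sphere, which is compact. *)
Lemma qform_le_posdef n (M M' : 'M[R]_n) : posdef M ->
  exists2 c : R, 0 <= c & forall x, qform M' x <= c * qform M x.
Proof.
move=> Mpos; pose S := [set x : 'cV[R]_n | sqnorm x = 1].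
have S0 x : S x -> x != 0.
  apply: contraPneq => ->; rewrite /S/= sqnorm_qform qform0 => /esym/eqP.
  by rewrite oner_eq0.
have cont : {within S, continuous (fun x => qform M' x / qform M x)}.
  apply: continuous_in_subspaceT => x; rewrite inE => /S0 x0.
  have Mx0 : qform M x != 0 by rewrite gt_eqF// Mpos.2.
  exact: (@cvgM _ _ (nbhs x)) (@qform_continuous _ M' x)
    (cvgV Mx0 (@qform_continuous _ M x)).
have := compact_bounded (continuous_compact cont (@compact_sphere n)).
move=> [a [_ aP]]; pose c := `|a| + 1.
exists c => [|x]; first by rewrite addr_ge0.
have [->|x0] := eqVneq x 0; first by rewrite !qform0 mulr0.
have s0 := sqnorm_gt0 x0.
pose y := (Num.sqrt (sqnorm x))^-1 *: x.
have yE N : qform N y = (sqnorm x)^-1 * qform N x.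
  by rewrite qformZv exprVn sqr_sqrtr// ltW.
have Sy : S y by rewrite /S/= sqnorm_qform yE -sqnorm_qform mulVf// gt_eqF.
have y0 := S0 _ Sy.
have := aP c; rewrite /c ltr_pwDr// ?ler_norm// => /(_ isT).
move=> /(_ (qform M' y / qform M y)) /= h.
have {h} : `|qform M' y / qform M y| <= c by apply: h; exists y.
move=> /(le_trans (ler_norm _)); rewrite ler_pdivrMr ?Mpos.2//.
by rewrite !yE mulrCA ler_pM2l// invr_gt0.
Qed.

Lemma posdef1 n : posdef (1%:M : 'M[R]_n).
Proof. by split=> [|x /sqnorm_gt0]; rewrite ?trmx1// sqnorm_qform. Qed.

Lemma compact_qform_le n (M : 'M[R]_n) (K : set 'cV[R]_n) : compact K ->
  exists2 c : R, 0 <= c & forall x, K x -> qform M x <= c.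
Proof.
move=> cK; have Mc : {within K, continuous (qform M)}.
  exact/continuous_subspaceT/qform_continuous.
have [c c0 cP] := pinfty_ex_gt0 (compact_bounded (continuous_compact Mc cK)).
exists c => [|x Kx]; first exact: ltW.
by apply: (le_trans (ler_norm _)); apply: cP; exists x.
Qed.

Lemma nbhs_qform_le n (M : 'M[R]_n) (r : R) : 0 < r ->
  nbhs (0 : 'cV[R]_n) [set x | qform M x <= r].
Proof.
move=> r0; have Mr : qform M 0 < r by rewrite qform0.
near=> x => /=; apply: ltW; near: x.
exact: cvgr_lt _ (@qform_continuous n M 0) r Mr.
Unshelve. all: by end_near. Qed.

End QuadraticForms.

(** * One-step risk *)

Lemma simplex_inhabited (R : realType) L (q : 'cV[R]_L) :
  simplex q -> inhabited 'I_L.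
Proof.
move=> [_ q1]; case: (pickP 'I_L) => [j _|L0]; first by exists.
by move: q1; rewrite big_pred0// => /esym/eqP; rewrite oner_eq0.
Qed.

Section OneStepRisk.
Variables (R : realType) (L : nat) (U : set 'cV[R]_L).
Hypothesis U_simplex : U `<=` @simplex R L.
Hypothesis U0 : U !=set0.

Definition worst_mean (z : 'I_L -> R) : R :=
  sup [set \sum_j q j 0 * z j | q in U].

Lemma mean_le_worst z q : U q -> \sum_j q j 0 * z j <= worst_mean z.
Proof.
move=> Uq; apply: ub_le_sup; last by exists q.
exists (\sum_j `|z j|) => _ [q' /U_simplex[q'0 q'1] <-].
apply: ler_sum => j _; apply: (le_trans (ler_norm _)).
rewrite normrM ger0_norm// ler_piMl//.
by rewrite -q'1 (bigD1 j)//= lerDl sumr_ge0.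
Qed.

Lemma worst_mean_le z b :
  (forall q, U q -> \sum_j q j 0 * z j <= b) -> worst_mean z <= b.
Proof.
move=> zb; apply: ge_sup => [|_ [q Uq <-]]; last exact: zb.
by case: U0 => q Uq; exists (\sum_j q j 0 * z j), q.
Qed.

Lemma le_worst_mean z z' : (forall j, z j <= z' j) -> worst_mean z <= worst_mean z'.
Proof.
move=> zz'; apply: worst_mean_le => q Uq.
apply: (le_trans _ (mean_le_worst z' Uq)); apply: ler_sum => j _.
by rewrite ler_wpM2l// (U_simplex Uq).1.
Qed.

Lemma worst_mean_cst (b : R) : worst_mean (fun=> b) = b.
Proof.
have bE q : U q -> \sum_j q j 0 * b = b.
  by move=> /U_simplex[_ q1]; rewrite -mulr_suml q1 mul1r.
apply/eqP; rewrite eq_le worst_mean_le/= => [|q /bE->//].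
by case: U0 => q Uq; rewrite -{1}(bE _ Uq); exact: (mean_le_worst (fun=> b)).
Qed.

Lemma worst_meanZ_le (a : R) z : 0 <= a ->
  worst_mean (fun j => a * z j) <= a * worst_mean z.
Proof.
move=> a0; apply: worst_mean_le => q Uq.
under eq_bigr do rewrite mulrCA.
by rewrite -mulr_sumr ler_wpM2l// mean_le_worst.
Qed.

End OneStepRisk.

Lemma sqnorm_convex_comb (R : realType) n (a b : 'cV[R]_n) (t : R) :
  sqnorm (t *: a + (1 - t) *: b) =
  t * sqnorm a + (1 - t) * sqnorm b - t * (1 - t) * sqnorm (a - b).
Proof.
rewrite !sqnormE !mulr_sumr -big_split/= -sumrB; apply: eq_bigr => i _.
by rewrite !mxE; ring.
Qed.

Lemma mean_continuous (R : realType) L (z : 'I_L -> R) :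
  continuous (fun q : 'cV[R]_L => \sum_j q j 0 * z j).
Proof.
apply: continuous_big => [|j _ q]; first exact: add_continuous.
exact: (@cvgM _ _ (nbhs q)) (@coord_continuous _ _ _ j 0 q) (cvg_cst _).
Qed.

(** A linear functional on a compact set attains its maximum at an extreme
    point: among the maximizers, take one of largest Euclidean norm. A proper
    convex combination equal to it consists of maximizers, whose norms are not
    larger, so strict convexity of the squared norm makes it trivial. *)
Lemma vertex_max_mean (R : realType) L (U : set 'cV[R]_L) (z : 'I_L -> R) :
  compact U -> U !=set0 ->
  exists2 v, vertices U v &
    forall q, U q -> \sum_j q j 0 * z j <= \sum_j v j 0 * z j.
Proof.
move=> cU U0; pose l (q : 'cV[R]_L) := \sum_j q j 0 * z j.
have [m mU lm] := compact_EVT_max U0 cU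
  (@continuous_subspaceT _ _ U l (@mean_continuous R L z)).
rewrite inE in mU.
have {}lm q : U q -> l q <= l m by move=> Uq; apply: lm; rewrite inE.
pose K := U `&` l @^-1` [set l m].
have cK : compact K.
  apply: compact_closedI => //.
  move/continuous_closedP : (@mean_continuous R L z); apply; exact: closed_eq.
have K0 : K !=set0 by exists m.
have [v vK sv] := compact_EVT_max K0 cK
  (@continuous_subspaceT _ _ K (@sqnorm R L) (@sqnorm_continuous R L)).
rewrite inE in vK; case: vK => Uv /= lv.
exists v; last by move=> q /lm; rewrite -lv.
split=> // a b t Ua Ub /andP[t0 t1] vE.
have lE : l v = t * l a + (1 - t) * l b.
  rewrite vE /l !mulr_sumr -big_split/=; apply: eq_bigr => j _.
  by rewrite !mxE; ring.
have la := lm a Ua; have lb := lm b Ub.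
have [laE lbE] : l a = l m /\ l b = l m by rewrite -lv in la lb *; split; nra.
have sa : sqnorm a <= sqnorm v by apply: sv; rewrite inE.
have sb : sqnorm b <= sqnorm v by apply: sv; rewrite inE.
have ab : a = b.
  apply/eqP; rewrite -subr_eq0; apply: contraTT isT => /sqnorm_gt0 ab0.
  have := sqnorm_convex_comb a b t; rewrite -vE => E.
  have := mulr_gt0 (mulr_gt0 t0 (_ : 0 < 1 - t)) ab0; rewrite subr_gt0 => /(_ t1).
  nra.
by subst b; rewrite vE -scalerDl addrC subrK scale1r.
Qed.

Lemma compact_polytope (R : realType) L mI mE (SI : 'M[R]_(mI, L))
    (TI : 'cV[R]_mI) (SE : 'M[R]_(mE, L)) (TE : 'cV[R]_mE) :
  compact (polytope SI TI SE TE).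
Proof.
have mulE m (S : 'M[R]_(m, L)) (q : 'cV[R]_L) i :
    (S *m q) i 0 = \sum_j q j 0 * S i j.
  by rewrite mxE; apply: eq_bigr => j _; rewrite mulrC.
apply: (subclosed_compact _ (@compact_colbox R L 1)); last first.
  move=> q [[q0 q1] _ _] i; rewrite in_itv/= (le_trans _ (q0 i)) ?lerN10//=.
  by rewrite -q1 (bigD1 i)//= lerDl sumr_ge0.
have -> : polytope SI TI SE TE =
    (\bigcap_(j : 'I_L) [set q | 0 <= q j 0])
    `&` [set q | \sum_j q j 0 * 1 = 1]
    `&` (\bigcap_i [set q | \sum_j q j 0 * SI i j <= TI i 0])
    `&` (\bigcap_i [set q | \sum_j q j 0 * SE i j = TE i 0]).
  apply/seteqP; split => q /=.
    move=> [[q0 q1] qI qE]; split; [split; [split|]|].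
    - by move=> j _; exact: q0.
    - by under eq_bigr do rewrite mulr1.
    - by move=> i _ /=; rewrite -mulE.
    - by move=> i _ /=; rewrite -mulE qE.
  move=> [[[q0 +] qI] qE]; under eq_bigr do rewrite mulr1; move=> q1.
  split; first by split=> // j; exact: q0.
  - by move=> i; rewrite mulE; exact: qI.
  - by apply/colP => i; rewrite mulE; exact: qE.
have cl_mean z (D : set R) : closed D ->
    closed [set q : 'cV[R]_L | D (\sum_j q j 0 * z j)].
  by move/continuous_closedP : (@mean_continuous R L z); exact.
apply: closedI; first apply: closedI; first apply: closedI.
- apply: closed_bigI => j _; move: (@closed_ge R 0).
  by move/continuous_closedP : (@coord_continuous R L 1 j 0); exact.
- exact: (cl_mean (fun=> 1) _ (@closed_eq R 1)).
- by apply: closed_bigI => i _; exact: (cl_mean (SI i) _ (@closed_le R (TI i 0))).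
- by apply: closed_bigI => i _; exact: (cl_mean (SE i) _ (@closed_eq R (TE i 0))).
Qed.

(** * Nested risk as a backward recursion *)

Section Bellman.
Variables (R : realType) (L : nat) (U : set 'cV[R]_L) (X : Type).

Fixpoint bellman (n : nat) (c : nat -> X -> R) (f : nat -> 'I_L -> X -> X)
    (x : X) : R :=
  if n is n'.+1 then
    c 0%N x + worst_mean U (fun j =>
      bellman n' (fun h => c h.+1) (fun h => f h.+1) (f 0%N j x))
  else c 0%N x.

(** The state at step h does not depend on the disturbances from time k + h
    on, so overwriting the disturbance of time k + h, as the risk at that time
    does, leaves it unchanged. *)
Lemma nested_risk_bellman (k : nat) (c : nat -> X -> R)
    (f : nat -> 'I_L -> X -> X) (s : dpath L -> nat -> X) (x : X)
    (Z : nat -> rvar R L) :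
  (forall w, s w 0%N = x) ->
  (forall w h, s w h.+1 = f h (w (k + h)%N) (s w h)) ->
  (forall w h, Z (k + h)%N w = c h (s w h)) ->
  forall n h w, nested_risk U n (k + h) Z w =
    bellman n (fun i => c (h + i)%N) (fun i => f (h + i)%N) (s w h).
Proof.
move=> s0 sS Zc.
have past w w' h : (forall i, (i < k + h)%N -> w i = w' i) -> s w h = s w' h.
  elim: h => [|h IH] ww'; first by rewrite !s0.
  rewrite !sS ww' ?addnS// IH// => i ih; apply: ww'.
  by rewrite addnS ltnW.
elim=> [|n IH] h w /=; first by rewrite Zc addn0.
rewrite Zc addn0; congr (_ + _); rewrite /risk /worst_mean.
congr (sup (_ @` _)); apply/funext => q; apply: eq_bigr => j _; congr (_ * _).
rewrite -addnS IH sS /= eqxx (past _ w) => [|i ih]; last first.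
  by rewrite /= ltn_eqF.
by congr bellman; apply/funext => i; rewrite addSnnS.
Qed.

End Bellman.

(** * A Lyapunov criterion for risk-sensitive exponential stability *)

Section Lyapunov.
Variables (R : realType) (L nx : nat) (U : set 'cV[R]_L).
Hypothesis U_simplex : U `<=` @simplex R L.
Hypothesis U0 : U !=set0.
Variable f : 'I_L -> 'cV[R]_nx -> 'cV[R]_nx.

Lemma markov_risk_sqnorm (x : 'cV[R]_nx) k w :
  markov_risk U 0 k
    (fun i w' => if i == k then sqnorm (state f x w' k) else 0) w =
  bellman U k (fun i y => if i == k then sqnorm y else 0) (fun=> f) x.
Proof.
rewrite /markov_risk subn0.
apply: (@nested_risk_bellman _ _ _ _ 0 (fun i y => if i == k then sqnorm y else 0)
  (fun=> f) (state f x) x _ _ _ _ k 0 w) => // w' h.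
by rewrite add0n; case: eqP => // ->.
Qed.

(** Each step of the recursion for the final squared norm pulls one factor
    lam out of the risk, by monotonicity and positive homogeneity; V is
    compared with the squared norm once at each end of the trajectory. *)
Lemma lyapunov_ulrses (D : set 'cV[R]_nx) (V : 'cV[R]_nx -> R) (a b lam : R) :
  nbhs (0 : 'cV[R]_nx) D -> bounded_set D ->
  0 <= a -> 0 <= b -> 0 <= lam < 1 ->
  (forall x, D x -> forall j, D (f j x)) ->
  (forall x, D x -> sqnorm x <= a * V x) ->
  (forall x, D x -> V x <= b * sqnorm x) ->
  (forall x, D x -> worst_mean U (fun j => V (f j x)) <= lam * V x) ->
  ulrses U f D.
Proof.
move=> D0 Dbnd a0 b0 lam01 Df lowV upV decV; split=> //.
exists (a * b), lam; split=> //; first exact: mulr_ge0.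
have lam0 : 0 <= lam by case/andP : lam01.
move=> x Dx k w; rewrite markov_risk_sqnorm.
suff {x Dx w} descent x : D x ->
    bellman U k (fun i y => if i == k then sqnorm y else 0) (fun=> f) x
      <= a * lam ^+ k * V x.
  apply: (le_trans (descent _ Dx)); rewrite (mulrAC a b) -(mulrA _ b).
  by rewrite ler_wpM2l ?upV// mulr_ge0// exprn_ge0.
elim: k x => [|k IH] x Dx /=; first by rewrite expr0 mulr1 lowV.
rewrite add0r (le_trans (le_worst_mean U_simplex U0 (fun j => IH _ (Df _ Dx j))))//.
have ak0 : 0 <= a * lam ^+ k by rewrite mulr_ge0// exprn_ge0.
rewrite (le_trans (worst_meanZ_le U_simplex U0 _ ak0))//.
by rewrite exprSr mulrA -[leRHS]mulrA ler_wpM2l// decV.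
Qed.

End Lyapunov.

(** * Predictive control with a terminal controller *)

Section PredictiveControl.
Variables (R : realType) (L nx nu : nat).
Variables (A : 'I_L -> 'M[R]_nx) (B : 'I_L -> 'M[R]_(nx, nu)).
Variables (U : set 'cV[R]_L) (Q : 'M[R]_nx) (Ru : 'M[R]_nu).
Variables (XX : set 'cV[R]_nx) (UU : set 'cV[R]_nu) (W P : 'M[R]_nx).
Hypothesis U_simplex : U `<=` @simplex R L.
Hypothesis U0 : U !=set0.

Definition predicted_cost (N : nat) (pi : policy R nx nu) (x : 'cV[R]_nx) : R :=
  bellman U N
    (fun h y => if (h < N)%N then stage_cost Q Ru y (pi h y) else qform P y)
    (fun h => closed_loop A B (pi h)) x.

Lemma predicted_cost0 pi x : predicted_cost 0 pi x = qform P x.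
Proof. by []. Qed.

Lemma predicted_costS N pi x :
  predicted_cost N.+1 pi x = stage_cost Q Ru x (pi 0%N x) +
    worst_mean U (fun j =>
      predicted_cost N (fun h => pi h.+1) (closed_loop A B (pi 0%N) j x)).
Proof. by []. Qed.

Lemma mpc_cost_predicted N k x pi w :
  mpc_cost A B U Q Ru P N k x pi w = predicted_cost N pi x.
Proof.
rewrite /mpc_cost /markov_risk addKn -[k in nested_risk _ _ k]addn0.
rewrite (@nested_risk_bellman _ _ _ _ k
  (fun h y => if (h < N)%N then stage_cost Q Ru y (pi h y) else qform P y)
  (fun h => closed_loop A B (pi h))
  (fun w h => pred_state A B k x pi w h) x)// => w' h.
by rewrite addKn ltn_add2l.
Qed.

(** Feasibility quantified over successor states instead of whole disturbance
    paths, so that it can be carried along an induction on the horizon together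
    with predicted_cost. *)
Fixpoint admissible (N : nat) (pi : policy R nx nu) (x : 'cV[R]_nx) : Prop :=
  XX x /\
  if N is N'.+1 then
    (forall y, XX y -> UU (pi 0%N y)) /\
    forall j, admissible N' (fun h => pi h.+1) (closed_loop A B (pi 0%N) j x)
  else ellipsoid W x.

Lemma admissible_state N pi x : admissible N pi x -> XX x.
Proof. by case: N => [|N] []. Qed.

Lemma pred_state_cons pi w x h :
  pred_state A B 0 x pi w h.+1 =
  pred_state A B 0 (closed_loop A B (pi 0%N) (w 0%N) x) (fun i => pi i.+1)
    (fun i => w i.+1) h.
Proof.
by elim: h => // h IH; rewrite [LHS]/= -/(pred_state _ _ _ _ _ _ h.+1) IH.
Qed.

(** The terminal constraint of a feasible policy is stated along disturbance
    paths, hence is vacuous unless some disturbance j0 exists. *)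
Lemma mpc_feasibleP (j0 : 'I_L) N pi x :
  mpc_feasible A B XX UU W N 0 x pi <-> admissible N pi x.
Proof.
split.
- elim: N pi x => [|N IH] pi x [Xx Upi paths]; split=> //.
    by have [_] := paths (fun=> j0).
  split=> [|j]; first exact: Upi.
  apply: IH; split.
  + by have [/(_ 0%N isT)[_]] := paths (fun=> j).
  + by move=> h hN; exact: Upi.
  + move=> w; pose jw i := if i is i'.+1 then w i' else j.
    have [stepok final] := paths jw.
    split; last by move: final; rewrite pred_state_cons.
    by move=> h hN; have := stepok h.+1 hN; rewrite !pred_state_cons.
- elim: N pi x => [|N IH] pi x [Xx]; first by move=> Ex; split.
  move=> [Upi succ]; split=> // [h|w].
    have [_ Utail _] := IH _ _ (succ j0).
    by case: h => [_|h hN]; [exact: Upi | exact: Utail].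
  have [Xw Utail /(_ (fun i => w i.+1))[stepok final]] := IH _ _ (succ (w 0%N)).
  split; last by rewrite pred_state_cons.
  case=> [_|h hN]; first by split; [exact: Upi|].
  by rewrite !(pred_state_cons pi); exact: stepok.
Qed.

Hypothesis Q_ge0 : forall x, 0 <= qform Q x.
Hypothesis Ru_ge0 : forall u, 0 <= qform Ru u.
Hypothesis P_ge0 : forall x, 0 <= qform P x.

Lemma predicted_cost_ge0 N pi x : 0 <= predicted_cost N pi x.
Proof.
elim: N pi x => [|N IH] pi x; first exact: P_ge0.
rewrite predicted_costS addr_ge0 ?addr_ge0//.
rewrite -[leLHS](worst_mean_cst U_simplex U0).
by apply: le_worst_mean => // j; exact: IH.
Qed.

Lemma stage_cost_le_predicted N pi x :
  stage_cost Q Ru x (pi 0%N x) <= predicted_cost N.+1 pi x.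
Proof.
rewrite predicted_costS lerDl -[leLHS](worst_mean_cst U_simplex U0).
by apply: le_worst_mean => // j; exact: predicted_cost_ge0.
Qed.

Lemma predicted_cost_bound N pi x (s t : R) :
  (forall y u, XX y -> UU u -> stage_cost Q Ru y u <= s) ->
  (forall y, XX y -> qform P y <= t) ->
  admissible N pi x -> predicted_cost N pi x <= s *+ N + t.
Proof.
move=> sle tle; elim: N pi x => [|N IH] pi x [Xx].
  by rewrite mulr0n add0r predicted_cost0 => _; exact: tle.
move=> [Upi succ]; rewrite predicted_costS mulrS -(addrA s) lerD//.
  by apply: sle => //; exact: Upi.
rewrite -[leRHS](worst_mean_cst U_simplex U0).
by apply: le_worst_mean => // j; exact: IH (succ j).
Qed.

Section TerminalController.
Variable g : 'cV[R]_nx -> 'cV[R]_nu.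
Hypothesis gU : forall y, UU (g y).
Hypothesis g_inv : forall y, XX y -> ellipsoid W y ->
  forall j, XX (closed_loop A B g j y) /\ ellipsoid W (closed_loop A B g j y).
Hypothesis g_dec : forall y, ellipsoid W y ->
  stage_cost Q Ru y (g y) + worst_mean U (fun j => qform P (closed_loop A B g j y))
    <= qform P y.

Definition extend (N : nat) (pi : policy R nx nu) : policy R nx nu :=
  fun h => if (h < N)%N then pi h else g.

Lemma admissible_extend N pi x :
  admissible N pi x -> admissible N.+1 (extend N pi) x.
Proof.
elim: N pi x => [|N IH] pi x [Xx].
  by move=> Ex; split=> //; split=> // j; exact: g_inv.
by move=> [Upi succ]; split=> //; split=> // j; exact: (IH _ _ (succ j)).
Qed.

(** The terminal cost is replaced by one more stage under g and the
    terminal cost after it, which g_dec says is no larger. *)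
Lemma predicted_cost_extend N pi x : admissible N pi x ->
  predicted_cost N.+1 (extend N pi) x <= predicted_cost N pi x.
Proof.
elim: N pi x => [|N IH] pi x [Xx]; first exact: g_dec.
move=> [_ succ]; rewrite predicted_costS [leRHS]predicted_costS lerD2l.
by apply: le_worst_mean => // j; exact: IH (succ j).
Qed.

Lemma admissible_terminal N x : XX x -> ellipsoid W x ->
  admissible N (fun=> g) x.
Proof.
elim: N x => [|N IH] x Xx Ex; split=> //; split=> // j.
by have [] := g_inv Xx Ex j; exact: IH.
Qed.

Lemma predicted_cost_terminal N x : XX x -> ellipsoid W x ->
  predicted_cost N (fun=> g) x <= qform P x.
Proof.
elim: N x => [//|N IH] x Xx Ex; rewrite predicted_costS.
apply: le_trans (g_dec Ex); rewrite lerD2l; apply: le_worst_mean => // j.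
by have [] := g_inv Xx Ex j; exact: IH.
Qed.

Section Law.
Variable j0 : 'I_L.
Variables (N : nat) (pi : 'cV[R]_nx -> 'cV[R]_nu).
Let D := mpc_domain A B XX UU W N.+1.
Variable pistar : 'cV[R]_nx -> policy R nx nu.
Hypothesis pistar_min : forall x, D x ->
  mpc_minimizer A B U Q Ru XX UU W P N.+1 0 x (pistar x).
Hypothesis pi_pistar : forall x, D x -> pi x = pistar x 0%N x.

Let V x := predicted_cost N.+1 (pistar x) x.

Lemma mpc_domainP x : D x <-> exists pi, admissible N.+1 pi x.
Proof. by split=> -[pi0 /(mpc_feasibleP j0)]; exists pi0. Qed.

Lemma mpc_step x j : D x ->
  closed_loop A B pi j x = closed_loop A B (pistar x 0%N) j x.
Proof. by move=> Dx; rewrite /closed_loop pi_pistar. Qed.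

Lemma mpc_value_min x pi' : D x -> admissible N.+1 pi' x ->
  V x <= predicted_cost N.+1 pi' x.
Proof.
move=> Dx /(mpc_feasibleP j0) adm.
have [_ minx] := pistar_min Dx.
by have := minx _ adm (fun=> j0); rewrite !mpc_cost_predicted.
Qed.

Lemma mpc_tail_admissible x j : D x ->
  admissible N (fun h => pistar x h.+1) (closed_loop A B pi j x).
Proof.
move=> Dx; rewrite mpc_step//.
by have [/(mpc_feasibleP j0)[_ [_ succ]] _] := pistar_min Dx; exact: succ.
Qed.

Lemma mpc_domain_invariant x j : D x -> D (closed_loop A B pi j x).
Proof.
move=> Dx; apply/mpc_domainP; exists (extend N (fun h => pistar x h.+1)).
exact: admissible_extend (mpc_tail_admissible j Dx).
Qed.

(** The tail of the optimal policy at x, followed by g, competes with the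
    optimal policy at each successor of x. *)
Lemma mpc_value_decrease x : D x ->
  qform Q x + worst_mean U (fun j => V (closed_loop A B pi j x)) <= V x.
Proof.
move=> Dx; rewrite {2}/V predicted_costS lerD//; first by rewrite lerDl.
apply: le_worst_mean => // j; rewrite -mpc_step//.
have adm := mpc_tail_admissible j Dx.
apply: (le_trans _ (predicted_cost_extend adm)).
by apply: mpc_value_min; [exact: mpc_domain_invariant | exact: admissible_extend].
Qed.

End Law.
End TerminalController.
End PredictiveControl.

(** * The terminal controller of the offline problem *)

Section OfflineProblem.
Variables (R : realType) (L nx nu mx mu : nat).
Variables (A : 'I_L -> 'M[R]_nx) (B : 'I_L -> 'M[R]_(nx, nu)).
Variables (U : set 'cV[R]_L) (Q : 'M[R]_nx) (Ru : 'M[R]_nu).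
Variables (Tx : 'M[R]_(mx, nx)) (xmax : R) (Tu : 'M[R]_(mu, nu)) (umax : R).
Variables (W P : 'M[R]_nx) (F : 'M[R]_(nu, nx)).
Hypothesis U_compact : compact U.
Hypothesis U_simplex : U `<=` @simplex R L.
Hypothesis U0 : U !=set0.
Hypothesis xmax0 : 0 < xmax.
Hypothesis umax0 : 0 < umax.
Hypothesis feas : pe_feasible A B U Q Ru Tx xmax Tu umax W P F.

(** A stage of a policy must map every state of the constraint set to an
    admissible input, and F does so only on the ellipsoid. *)
Definition terminal_controller (y : 'cV[R]_nx) : 'cV[R]_nu :=
  if `[< ellipsoid W y >] then F *m y else 0.

Let g := terminal_controller.

Lemma terminal_closed_loop y j : ellipsoid W y ->
  closed_loop A B g j y = (A j + B j *m F) *m y.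
Proof.
move=> Ey; rewrite /closed_loop /g /terminal_controller asboolT//.
by rewrite mulmxDl mulmxA.
Qed.

Lemma ball_of_negsemidef k m n (T : 'M[R]_(k, m)) (r : R) (G : 'M[R]_(m, n)) M x :
  0 < r -> negsemidef (G^T *m ((r ^+ 2)^-1 *: (T^T *m T)) *m G - M) ->
  qform M x <= 1 -> ball_constraint T r (G *m x).
Proof.
move=> r0 [_ /(_ x)]; rewrite qformD qformN qform_congr qformZ qform_gram.
rewrite subr_le0 => le1 /(le_trans le1); rewrite mulrC ler_pdivrMr ?exprn_gt0//.
by rewrite mul1r /ball_constraint/= norm2_le.
Qed.

Lemma terminal_controller_input y : ball_constraint Tu umax (g y).
Proof.
have [_ _ inputF _ _] := feas; rewrite /g /terminal_controller.
case: asboolP => [Ey|_]; first exact: ball_of_negsemidef inputF Ey.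
rewrite /ball_constraint/= norm2_le// sqnorm_qform mulmx0 qform0.
exact: sqr_ge0.
Qed.

Lemma terminal_invariant y j : ellipsoid W y ->
  ball_constraint Tx xmax (closed_loop A B g j y) /\
  ellipsoid W (closed_loop A B g j y).
Proof.
move=> Ey; have [_ _ _ _ /(_ j)[stateF [_ /(_ y)]]] := feas.
rewrite qformD qformN qform_congr subr_le0 => decW.
rewrite terminal_closed_loop//; split; first exact: ball_of_negsemidef stateF Ey.
exact: le_trans decW Ey.
Qed.

(** The matrix inequality is imposed at the vertices only; it extends to the
    whole set because the expected terminal cost is linear in the pmf. *)
Lemma terminal_decrease y : ellipsoid W y ->
  stage_cost Q Ru y (g y) +
    worst_mean U (fun j => qform P (closed_loop A B g j y)) <= qform P y.
Proof.
move=> Ey; under eq_fun do rewrite terminal_closed_loop//.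
rewrite /g /terminal_controller asboolT// -lerBrDl; apply: worst_mean_le => // q Uq.
have [v vert vmax] := vertex_max_mean
  (fun j => qform P ((A j + B j *m F) *m y)) U_compact U0.
apply: (le_trans (vmax _ Uq)); have [_ _ _ /(_ v vert)[_ negF] _] := feas.
have [->|/negF/ltW] := eqVneq y 0.
  rewrite /stage_cost mulmx0 !qform0 addr0 subr0 big1// => j _.
  by rewrite mulmx0 qform0 mulr0.
rewrite !qformD qformN qform_sum !qform_congr /stage_cost.
under eq_bigr do rewrite qformZ qform_congr.
lra.
Qed.

End OfflineProblem.

(** * Closed-loop stability *)

Theorem theorem7p4 (R : realType) (L nx nu mx mu mI mE : nat)
  (A : 'I_L -> 'M[R]_nx) (B : 'I_L -> 'M[R]_(nx, nu))
  (p : 'cV[R]_L) (hp : simplex p) (hp_gt0 : forall j, 0 < p j 0)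
  (SI : 'M[R]_(mI, L)) (TI : 'cV[R]_mI)
  (SE : 'M[R]_(mE, L)) (TE : 'cV[R]_mE)
  (hU : polytope SI TI SE TE !=set0)
  (Q : 'M[R]_nx) (hQ : posdef Q) (Ru : 'M[R]_nu) (hRu : posdef Ru)
  (Tx : 'M[R]_(mx, nx)) (xmax : R) (hxmax : 0 < xmax)
  (Tu : 'M[R]_(mu, nu)) (umax : R) (humax : 0 < umax)
  (hXcompact : compact (ball_constraint Tx xmax))
  (hXconvex : convex_set (ball_constraint Tx xmax))
  (hUcompact : compact (ball_constraint Tu umax))
  (hUconvex : convex_set (ball_constraint Tu umax))
  (hPE : exists W P F,
     pe_feasible A B (polytope SI TI SE TE) Q Ru Tx xmax Tu umax W P F)
  (Wstar Pstar : 'M[R]_nx)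
  (hstar : exists F, pe_maximizer A B (polytope SI TI SE TE) Q Ru
     Tx xmax Tu umax Wstar Pstar F)
  (N : nat) (hN : (1 <= N)%N)
  (x0 : 'cV[R]_nx)
  (hx0 : mpc_domain A B (ball_constraint Tx xmax) (ball_constraint Tu umax)
     Wstar N x0)
  (piMPC : 'cV[R]_nx -> 'cV[R]_nu)
  (hpi : mpc_law A B (polytope SI TI SE TE) Q Ru
     (ball_constraint Tx xmax) (ball_constraint Tu umax) Wstar Pstar N piMPC) :
  ulrses (polytope SI TI SE TE) (closed_loop A B piMPC)
    (mpc_domain A B (ball_constraint Tx xmax) (ball_constraint Tu umax)
       Wstar N).
Proof.
have U_simplex : polytope SI TI SE TE `<=` @simplex R L by move=> q [].
have U_compact := @compact_polytope R L mI mE SI TI SE TE.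
have [F [feas _]] := hstar.
have [j0] := simplex_inhabited hp.
case: N hN hx0 hpi => [//|N] _ _ hpi.
set U := polytope SI TI SE TE in hU U_simplex U_compact feas hpi *.
set XX := ball_constraint Tx xmax in hXcompact hpi *.
set UU := ball_constraint Tu umax in hUcompact hpi *.
set D := mpc_domain A B XX UU Wstar N.+1.
have Q_ge0 x := posdef_ge0 x hQ.
have Ru_ge0 u := posdef_ge0 u hRu.
have P_ge0 x : 0 <= qform Pstar x by have [_ /posdef_ge0] := feas; exact.
pose g := terminal_controller Wstar F.
have gU : forall y, UU (g y) by move=> y; exact: terminal_controller_input feas _.
have g_inv y : XX y -> ellipsoid Wstar y ->
    forall j, XX (closed_loop A B g j y) /\ ellipsoid Wstar (closed_loop A B g j y).
  by move=> _ Ey j; exact: terminal_invariant feas _ _ Ey.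
have g_dec y (Ey : ellipsoid Wstar y) :=
  terminal_decrease U_compact hU feas Ey.
have [pistar pistarP] : exists ps : 'cV[R]_nx -> policy R nx nu, forall x, D x ->
    mpc_minimizer A B U Q Ru XX UU Wstar Pstar N.+1 0 x (ps x) /\
    piMPC x = ps x 0%N x.
  suff /choice[ps psP] : forall x, exists ps, D x ->
      mpc_minimizer A B U Q Ru XX UU Wstar Pstar N.+1 0 x ps /\
      piMPC x = ps 0%N x by exists ps.
  move=> x; have [Dx|nDx] := pselect (D x); last by exists (fun _ _ => 0).
  by have [ps] := hpi 0%N x Dx; exists ps.
have pistar_min x Dx := (pistarP x Dx).1.
have pi_pistar x Dx := (pistarP x Dx).2.
pose V x := predicted_cost A B U Q Ru Pstar N.+1 (pistar x) x.
have D_adm x : D x -> admissible A B XX UU Wstar N.+1 (pistar x) x.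
  by move=> /pistar_min[/(mpc_feasibleP _ _ _ _ _ j0)].
have D_XX x : D x -> XX x by move=> /D_adm/admissible_state.
have terminal_D x : XX x -> ellipsoid Wstar x -> D x.
  move=> Xx Ex; exists (fun=> g).
  by apply/(mpc_feasibleP _ _ _ _ _ j0); exact: admissible_terminal.
have QV x : D x -> qform Q x <= V x.
  move=> Dx; apply: le_trans
    (stage_cost_le_predicted _ _ U_simplex hU Q_ge0 Ru_ge0 P_ge0 _ _ _).
  by rewrite lerDl.
have [a a0 aP] := qform_le_posdef 1%:M hQ.
have [bP bP0 bPP] := qform_le_posdef Pstar (@posdef1 R nx).
have [bW bW0 bWP] := qform_le_posdef (invmx Wstar) (@posdef1 R nx).
have [cQ cQ0 cQP] := compact_qform_le Q hXcompact.
have [cR cR0 cRP] := compact_qform_le Ru hUcompact.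
have [cP cP0 cPP] := compact_qform_le Pstar hXcompact.
pose M := (cQ + cR) *+ N.+1 + cP.
have M0 : 0 <= M by rewrite addr_ge0// mulrn_wge0// addr_ge0.
pose b := bP + M * bW.
have b0 : 0 <= b by rewrite addr_ge0// mulr_ge0.
(* Off the ellipsoid a bounded V is quadratically bounded, x^T W^-1 x being
   larger than 1 there. *)
have Vb x : D x -> V x <= b * sqnorm x.
  move=> Dx; rewrite sqnorm_qform /b mulrDl -mulrA.
  have [Ex|nEx] := pselect (ellipsoid Wstar x).
    apply: (@le_trans _ _ (qform Pstar x)).
      apply: le_trans (predicted_cost_terminal U_simplex hU g_inv g_dec N.+1
        (D_XX _ Dx) Ex).
      apply: (mpc_value_min j0 pistar_min) => //.
      exact: admissible_terminal (D_XX _ Dx) Ex.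
    rewrite (le_trans (bPP x))// lerDl mulr_ge0// mulr_ge0//.
    exact/posdef_ge0/posdef1.
  have VM : V x <= M.
    apply: (predicted_cost_bound U_simplex hU _ cPP (D_adm _ Dx)) => y u Xy Uu.
    by apply: lerD; [exact: cQP | exact: cRP].
  apply: (le_trans VM); rewrite ler_wpDl//.
    by rewrite mulr_ge0//; exact/posdef_ge0/posdef1.
  rewrite ler_peMr//; apply: (le_trans _ (bWP x)).
  by move/negP : nEx; rewrite -ltNge => /ltW.
(* V x <= b |x|^2 <= b a x^T Q x; adding 1 makes c >= 1, so that the
   contraction factor 1 - c^-1 lies in [0, 1). *)
pose c := b * a + 1.
have c1 : 1 <= c by rewrite lerDr mulr_ge0.
have c0 : 0 < c by exact: lt_le_trans ltr01 c1.
have VQ x : D x -> c^-1 * V x <= qform Q x.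
  move=> Dx; rewrite ler_pdivrMl// (le_trans (Vb _ Dx))//.
  rewrite /c [leRHS]mulrDl mul1r -(mulrA b) ler_wpDr// ler_wpM2l//.
  by rewrite sqnorm_qform aP.
apply: (@lyapunov_ulrses _ _ _ _ U_simplex hU _ _ V a b (1 - c^-1)) => //.
- apply: (@filterS _ _ _ (XX `&` ellipsoid Wstar)) => [x []|].
    exact: terminal_D.
  apply: filterI; last exact: nbhs_qform_le.
  have -> : XX = [set x | qform (Tx^T *m Tx) x <= xmax ^+ 2].
    by apply/funext => x; rewrite /XX /ball_constraint/= qform_gram norm2_le.
  by apply: nbhs_qform_le; exact: exprn_gt0.
- have [r0 [r0_real r0P]] := compact_bounded hXcompact.
  by exists r0; split=> // r /r0P XXr x /D_XX; exact: XXr.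
- by rewrite subr_ge0 invf_le1// c1/= gtrBl invr_gt0.
- move=> x Dx j.
  exact: (mpc_domain_invariant gU g_inv j0 pistar_min pi_pistar).
- move=> x Dx; rewrite sqnorm_qform (le_trans (aP x))// ler_wpM2l//.
  exact: QV.
- move=> x Dx.
  have decx : qform Q x +
      worst_mean U (fun j => V (closed_loop A B piMPC j x)) <= V x.
    exact: (mpc_value_decrease U_simplex hU Ru_ge0 gU g_inv g_dec j0
      pistar_min pi_pistar).
  have := VQ x Dx; lra.
Qed.
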